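(* Let $\mathcal{X}$ be a compact set equipped with a probability measure $\mu$ (e.g. the uniform distribution). Let $\pi:\mathcal{X}\to(0,1)$ be measurable with $m:=\inf_{x}\pi(x)>0$, and set $L_\pi:=1/m$. Let $\hat\pi:\mathcal{X}\to\mathbb{R}$ and $\sigma:\mathcal{X}\to[0,\infty)$ be measurable and $\beta\ge0$ such that $|\pi(x)-\hat\pi(x)|\le\beta\sigma(x)$ for all $x\in\mathcal{X}$. Define $u(x):=\min\{1,\max\{0,\hat\pi(x)+\beta\sigma(x)\}\}$, the densities (w.r.t. $\mu$) $\hat p(x):=u(x)/\int u\,d\mu$ and $\ell(x):=\pi(x)/\int\pi\,d\mu$. Then $$\mathrm{KL}(\hat p\,\|\,\ell)\le 2L_\pi\,\beta\,\mathbb{E}_{x\sim\hat p}[\sigma(x)].$$ In particular, in the batch BORE++ setting, with $\hat\pi=\hat\pi_{t-1}$, $\sigma=\sigma_{t-1}$, $\beta=\beta_{t-1}(\delta)$ on the high-probability event of the confidence bound, the target batch-sampling distribution $\hat p_t\propto\pi_{t-1,\delta}$ satisfies $\mathrm{KL}(\hat p_t\|\ell)\le 2L_\pi\beta_{t-1}(\delta)\mathbb{E}_{\hat p_t}[\sigma_{t-1}]$, where $\ell(x)=p(x\mid y\le\tau)$.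
   Context: $\mathrm{KL}(p\|q):=\mathbb{E}_{x\sim p}[\log p(x)-\log q(x)]$. Note $u\ge\pi>0$ under the hypothesis, so $\hat p$ is well defined. In the batch BORE++ setting, $\pi(x)=\Phi_\epsilon(\tau-f(x))=p(y\le\tau\mid x)$ and $\pi_{t,\delta}:=\min\{1,\max\{0,\hat\pi_t+\beta_t(\delta)\sigma_t\}\}$ with $\hat\pi_t,\sigma_t,\beta_t$ the kernel least-squares estimator, posterior standard deviation and confidence width computed from all observations collected so far. *)

(* Defs.v *)
From HB Require Import structures.
From mathcomp Require Import all_boot all_order all_algebra.
From mathcomp Require Import all_classical all_reals all_analysis.
Set Implicit Arguments. Unset Strict Implicit. Unset Printing Implicit Defensive.
Import Order.TTheory GRing.Theory Num.Theory.
Local Open Scope classical_set_scope.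
Local Open Scope ring_scope.

Section Defs.
Context (d : measure_display) (T : measurableType d) (R : realType).

Definition ucb (pihat sigma : T -> R) (beta : R) (x : T) : R :=
  Num.min 1 (Num.max 0 (pihat x + beta * sigma x)).

Definition normalize (mu : {measure set T -> \bar R}) (f : T -> R) (x : T) : R :=
  f x / (\int[mu]_(y in setT) f y)%R.

Definition KLdiv (mu : {measure set T -> \bar R}) (p q : T -> R) : \bar R :=
  (\int[mu]_x (if p x == 0 then 0 else p x * (ln (p x) - ln (q x)))%:E)%E.

Definition expect_dens (mu : {measure set T -> \bar R}) (p f : T -> R) : \bar R :=
  (\int[mu]_x (p x * f x)%:E)%E.

End Defs.

(* Main.v *)
Require Import Defs.
From HB Require Import structures.
From mathcomp Require Import all_boot all_order all_algebra.
From mathcomp Require Import all_classical all_reals all_analysis.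
From mathcomp Require Import measurable_realfun lra ring.
Set Implicit Arguments. Unset Strict Implicit. Unset Printing Implicit Defensive.
Import Order.TTheory GRing.Theory Num.Theory.
Local Open Scope classical_set_scope.
Local Open Scope ring_scope.

(* Since |pi - pihat| <= beta sigma, the clipped bound u satisfies
   pi <= u <= pi + 2 beta sigma.  Hence int pi <= int u, and the log-ratio of
   the normalized densities is bounded pointwise:
   ln (u / int u) - ln (pi / int pi) <= ln (u / pi) <= u / pi - 1 <= 2 beta sigma / m.
   Weighting by u / int u and integrating gives the bound. *)

Section ucb.
Context d (T : measurableType d) (R : realType).
Variables (pi pihat sigma : T -> R) (beta : R).
Hypothesis pihat_conf : forall x, `|pi x - pihat x| <= beta * sigma x.

Lemma ucb_le1 x : ucb pihat sigma beta x <= 1.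
Proof. by rewrite /ucb ge_min lexx. Qed.

Lemma le_ucb x : pi x <= 1 -> pi x <= ucb pihat sigma beta x.
Proof.
move=> pi1; have := pihat_conf x; rewrite ler_norml => /andP[_ conf].
by rewrite /ucb le_min pi1 le_max; apply/orP; right; lra.
Qed.

Lemma ucb_sub_le x : 0 <= pi x -> ucb pihat sigma beta x - pi x <= 2 * (beta * sigma x).
Proof.
move=> pi0; have := pihat_conf x; rewrite ler_norml => /andP[conf _].
have umax : ucb pihat sigma beta x <= Num.max 0 (pihat x + beta * sigma x).
  by rewrite /ucb ge_min lexx orbT.
have bs0 := le_trans (normr_ge0 _) (pihat_conf x).
by move: umax; rewrite le_max => /orP[]; lra.
Qed.

Lemma measurable_ucb : measurable_fun setT pihat -> measurable_fun setT sigma ->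
  measurable_fun setT (ucb pihat sigma beta).
Proof.
move=> mpihat msigma.
apply: measurable_minr; first exact: measurable_cst.
apply: measurable_maxr; first exact: measurable_cst.
by apply: measurable_funD => //; exact: measurable_funM.
Qed.

End ucb.

(* No integrability of f is needed: int f = int f^+ - int f^- <= int f^+. *)
Lemma le_integral_ge0r d (T : measurableType d) (R : realType)
    (mu : {measure set T -> \bar R}) (D : set T) (f g : T -> \bar R) :
  measurable D -> measurable_fun D f -> measurable_fun D g ->
  (forall x, D x -> 0 <= g x)%E -> (forall x, D x -> f x <= g x)%E ->
  (\int[mu]_(x in D) f x <= \int[mu]_(x in D) g x)%E.
Proof.
move=> mD mf mg g0 fg; rewrite integralE.
apply: (@le_trans _ _ (\int[mu]_(x in D) f^\+ x - 0)%E).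
  by apply: leeB => //; apply: integral_ge0 => x _; exact: funeneg_ge0.
rewrite sube0.
apply: ge0_le_integral => //; first exact: measurable_funepos.
by move=> x Dx; rewrite funeposE ge_max fg // g0.
Qed.

Lemma ln_div_ratio_le (R : realType) (p q A B : R) :
  0 < p -> 0 < q -> 0 < B <= A -> ln (q / A) - ln (p / B) <= (q - p) / p.
Proof.
move=> p0 q0 /andP[B0 BA]; have A0 := lt_le_trans B0 BA.
rewrite -ln_div ?posrE ?divr_gt0 //.
have -> : q / A / (p / B) = q / p * (B / A).
  by field; rewrite !gt_eqF.
rewrite lnM ?posrE ?divr_gt0 //.
have lnBA : ln (B / A) <= 0 by apply: ln_le0; rewrite ler_pdivrMr // mul1r.
have lnqp : ln (q / p) <= q / p - 1.
  have := @le_ln1Dx R (q / p - 1); rewrite [1 + _]addrC subrK; apply.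
  by rewrite ltrBrDl subrr divr_gt0.
have -> : (q - p) / p = q / p - 1 by field; rewrite gt_eqF.
lra.
Qed.

Lemma ln_ucb_div_le d (T : measurableType d) (R : realType)
    (pi pihat sigma : T -> R) (beta m A B : R) x :
  (forall x, `|pi x - pihat x| <= beta * sigma x) ->
  0 < m <= pi x -> pi x <= 1 -> 0 < B <= A ->
  ln (ucb pihat sigma beta x / A) - ln (pi x / B) <= 2 * m^-1 * beta * sigma x.
Proof.
move=> conf /andP[m0 m_le_pix] pix1 BA; have pix0 := lt_le_trans m0 m_le_pix.
apply: le_trans (ln_div_ratio_le pix0 (lt_le_trans pix0 (le_ucb conf pix1)) BA) _.
rewrite ler_pdivrMr //.
have := ucb_sub_le conf (ltW pix0).
have : 1 <= m^-1 * pi x by rewrite ler_pdivlMl // mulr1.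
have := le_trans (normr_ge0 _) (conf x).
nra.
Qed.

Section probability_bounded.
Context d (T : measurableType d) (R : realType) (mu : probability T R).
Variables (h : T -> R) (a b : R).
Hypotheses (mh : measurable_fun setT h) (a0 : 0 <= a) (h_bnd : forall x, a <= h x <= b).

Let integral_cst_probability (k : R) : (\int[mu]_x k%:E = k%:E)%E.
Proof. by rewrite integral_cst //= probability_setT mule1. Qed.

Lemma probability_integral_bounds :
  (a%:E <= \int[mu]_x (h x)%:E <= b%:E)%E.
Proof.
have mhE := (measurable_EFinP setT h).2 mh.
have h0 x : 0 <= h x by case/andP: (h_bnd x) => /(le_trans a0).
apply/andP; split.
- rewrite -[leLHS]integral_cst_probability; apply: ge0_le_integral => //= x _.
  by rewrite lee_fin; case/andP: (h_bnd x).
- rewrite -[leRHS]integral_cst_probability.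
  by apply: ge0_le_integral => //= x _; rewrite lee_fin ?h0 //; case/andP: (h_bnd x).
Qed.

Lemma probability_RintegralE : (\int[mu]_x h x)%:E = (\int[mu]_x (h x)%:E)%E.
Proof.
case/andP: probability_integral_bounds => ge_a le_b; apply: fineK.
by rewrite fin_numElt (lt_le_trans (ltNyr a)) ?(le_lt_trans le_b (ltry b)).
Qed.

Lemma probability_Rintegral_bounds : a <= \int[mu]_x h x <= b.
Proof. by rewrite -!lee_fin probability_RintegralE probability_integral_bounds. Qed.

End probability_bounded.

Lemma probability_le_Rintegral d (T : measurableType d) (R : realType)
    (mu : probability T R) (f g : T -> R) (a b : R) :
  measurable_fun setT f -> measurable_fun setT g -> 0 <= a ->
  (forall x, a <= f x <= b) -> (forall x, a <= g x <= b) ->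
  (forall x, f x <= g x) -> \int[mu]_x f x <= \int[mu]_x g x.
Proof.
move=> mf mg a0 f_bnd g_bnd fg.
rewrite -lee_fin (probability_RintegralE mu mf a0 f_bnd).
rewrite (probability_RintegralE mu mg a0 g_bnd).
apply: ge0_le_integral => //=; try exact/measurable_EFinP.
- by move=> x _; rewrite lee_fin (le_trans a0) //; case/andP: (f_bnd x).
- by move=> x _; rewrite lee_fin.
Qed.

Section KLdiv_bound.
Context d (T : measurableType d) (R : realType) (mu : {measure set T -> \bar R}).

Lemma measurable_normalize (f : T -> R) :
  measurable_fun setT f -> measurable_fun setT (normalize mu f).
Proof. by move=> mf; apply: measurable_funM => //; exact: measurable_cst. Qed.

Lemma KLdiv_le_expect (p q f : T -> R) (c : R) :
  measurable_fun setT p -> measurable_fun setT q -> measurable_fun setT f ->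
  (forall x, 0 < p x) -> (forall x, 0 <= f x) -> 0 <= c ->
  (forall x, ln (p x) - ln (q x) <= c * f x) ->
  (KLdiv mu p q <= c%:E * expect_dens mu p f)%E.
Proof.
move=> mp mq mf p0 f0 c0 lnpq.
have mpf : measurable_fun setT (fun x => p x * f x) by exact: measurable_funM.
have pf0 x : 0 <= p x * f x by rewrite mulr_ge0 // ltW.
rewrite /KLdiv /expect_dens -ge0_integralZl //=; last first.
  - by move=> x _; rewrite lee_fin.
  - exact/measurable_EFinP.
rewrite (eq_integral (fun x => (p x * (ln (p x) - ln (q x)))%:E)); last first.
  by move=> x _; rewrite gt_eqF.
apply: le_integral_ge0r => //.
- apply/measurable_EFinP; apply: measurable_funM => //.
  by apply: measurable_funB; exact: measurableT_comp.
- by apply/measurable_EFinP; exact: measurable_funM.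
- by move=> x _; rewrite lee_fin mulr_ge0.
- by move=> x _; rewrite lee_fin mulrCA ler_wpM2l // ltW.
Qed.

End KLdiv_bound.

Theorem mainTheorem5 (d : measure_display) (T : measurableType d) (R : realType)
  (mu : probability T R) (pi pihat sigma : T -> R) (beta : R) :
  measurable_fun setT pi ->
  (forall x, 0 < pi x < 1) ->
  0 < inf (range pi) ->
  measurable_fun setT pihat ->
  measurable_fun setT sigma ->
  (forall x, 0 <= sigma x) ->
  0 <= beta ->
  (forall x, `|pi x - pihat x| <= beta * sigma x) ->
  (KLdiv mu (normalize mu (ucb pihat sigma beta)) (normalize mu pi)
   <= (2 * (inf (range pi))^-1 * beta)%:E
      * expect_dens mu (normalize mu (ucb pihat sigma beta)) sigma)%E.
Proof.
move=> mpi pi01 m0 mpihat msigma sigma0 beta0 conf.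
set m := inf (range pi); set u := ucb pihat sigma beta.
have mu_u : measurable_fun setT u by exact: measurable_ucb.
have pi_bnd x : m <= pi x <= 1.
  have [pi0 pi1] := andP (pi01 x); rewrite (ltW pi1) andbT.
  by apply: ge_inf; [exists 0 => _ [y _ <-]; case/andP: (pi01 y) => /ltW|exists x].
have le_pi_u x : pi x <= u x by apply: le_ucb; case/andP: (pi_bnd x).
have u_bnd x : m <= u x <= 1.
  by rewrite ucb_le1 andbT (le_trans _ (le_pi_u x)) //; case/andP: (pi_bnd x).
have /andP[mA _] := probability_Rintegral_bounds mu mu_u (ltW m0) u_bnd.
have /andP[mB _] := probability_Rintegral_bounds mu mpi (ltW m0) pi_bnd.
have BA := probability_le_Rintegral mu mpi mu_u (ltW m0) pi_bnd u_bnd le_pi_u.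
apply: KLdiv_le_expect => //; try exact: measurable_normalize.
- by move=> x; rewrite /normalize divr_gt0 // (lt_le_trans m0) //; case/andP: (u_bnd x).
- by rewrite mulr_ge0 // mulr_ge0 // invr_ge0 ltW.
move=> x; have /andP[m_le_pix pix1] := pi_bnd x.
by apply: ln_ucb_div_le; rewrite ?m0 ?m_le_pix ?(lt_le_trans m0 mB) ?BA.
Qed.
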